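(* Let $G$ be a directed weighted graph with $N$ nodes, with edge weights $c(s,s')\in\mathbb{R}\cup\{\infty\}$ (where $c(s,s')=\infty$ encodes that there is no edge from $s$ to $s'$), and suppose that $G$ has no negative cycles. For each integer $k\ge 0$ and nodes $s,s'$, let $V_k(s,s')$ denote the cost of the shortest path from $s$ to $s'$ in $2^k$ steps or less, and let $V^*(s,s')$ denote the cost of the shortest path from $s$ to $s'$ (with any number of steps). Then $V_k$ can be computed according to the following equations, i.e. the functions $V_k$ satisfy: $$V_0(s,s') = c(s,s') \quad \text{for all } s,s' \text{ with } s\neq s';$$ $$V_k(s,s) = 0 \quad \text{for all } s \text{ and all } k\ge 0;$$ $$V_k(s,s') = \min_{s_m}\left\{ V_{k-1}(s,s_m) + V_{k-1}(s_m,s')\right\} \quad \text{for all } s,s' \text{ with } s\neq s' \text{ and all } k\ge 1,$$ where the minimum is over all nodes $s_m$ of the graph. Furthermore, for every integer $k\ge \log_2(N)$, $V_k(s,s') = V^*(s,s')$ for all nodes $s,s'$.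
   Context: The graph is finite and directed, with nodes $s_1,\dots,s_N$; $c(s,s')$ is the weight of the edge $s\to s'$. Unconnected pairs are replaced by edges of weight $\infty$, so that the graph is regarded as complete. A path from $s$ to $s'$ with $T$ steps is a sequence of nodes $s=x_0,x_1,\dots,x_T=s'$ (nodes may repeat), and its cost is $\sum_{t=0}^{T-1} c(x_t,x_{t+1})$, with the usual convention that a sum involving $\infty$ equals $\infty$. The path with zero steps from a node to itself is allowed and has cost $0$. A shortest path is a path of minimum cost; if no path of finite cost of the required kind exists, the corresponding value is $\infty$. A negative cycle is a path with at least one step from a node to itself having negative total cost. *)

(* Defs.v *)
From mathcomp Require Import all_boot all_order all_algebra.
From mathcomp Require Import all_classical all_reals all_analysis.

Set Implicit Arguments.
Unset Strict Implicit.
Unset Printing Implicit Defensive.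

Local Open Scope classical_set_scope.
Local Open Scope ereal_scope.

(* The value -oo is attained exactly when A has no least element (or has the
   least element -oo itself).  Path costs are never -oo, so an equation between
   such a minimum and anything other than -oo asserts that the minimum exists. *)
Definition minimum (R : realType) (A : set (\bar R)) : \bar R :=
  xget -oo (A `&` lbound A).

(* A path x_0, x_1, .., x_n is represented by its start x_0 and the sequence
   [:: x_1; ..; x_n], whose size is the number of steps. *)
Definition path_cost (R : realType) (S : finType) (c : S -> S -> \bar R)
    (s : S) (p : seq S) : \bar R :=
  \sum_(w <- pairmap c s p) w.

Definition negative_cycle (R : realType) (S : finType) (c : S -> S -> \bar R)
    (s : S) (p : seq S) : Prop :=
  [/\ (0 < size p)%N, last s p = s & path_cost c s p < 0].

(* The graph is complete (absent edges weigh +oo), so for distinct s, s' without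
   a connecting path of finite cost, this minimum is +oo. *)
Definition Vstar (R : realType) (S : finType) (c : S -> S -> \bar R)
    (s s' : S) : \bar R :=
  minimum [set path_cost c s p | p in [set p | last s p = s']].

Definition V (R : realType) (S : finType) (c : S -> S -> \bar R)
    (k : nat) (s s' : S) : \bar R :=
  minimum [set path_cost c s p
          | p in [set p | last s p = s' /\ (size p <= 2 ^ k)%N]].

(* Main.v *)
(* A path of at most [2^k.+1] steps splits into two paths of at most [2^k]
   steps each, and conversely two such paths concatenate, whence the recurrence.
   Without negative cycles, excising a cycle never increases the cost, so every
   path is dominated by one without repeated nodes, which has fewer than
   [N <= 2^k] steps. *)
Require Import Defs.
From mathcomp Require Import all_boot all_order all_algebra.
From mathcomp Require Import all_classical all_reals all_analysis.

Local Open Scope ereal_scope.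

Import Order.TTheory GRing.Theory Num.Theory.

Lemma minimum_eq (R : realType) (A : set (\bar R)) (x : \bar R) :
  A x -> lbound A x -> minimum A = x.
Proof.
move=> Ax lbx; apply: xget_unique => [//|y [Ay lby]].
by apply/eqP; rewrite eq_le lby ?lbx.
Qed.

Lemma log2_le_leq_exp2 (R : realType) (N k : nat) :
  (ln N%:R / ln 2 <= k%:R :> R)%R -> (N <= 2 ^ k)%N.
Proof.
(* [N = 0] is split off because [ln] is monotone only on positive arguments. *)
case: N => [//|N]; rewrite ler_pdivrMr ?ln_gt0 ?ltr1n// mulr_natl -lnXn//.
by rewrite ler_ln ?posrE ?exprn_gt0// -natrX ler_nat.
Qed.

Section PathCost.
Variables (R : realType) (S : finType) (c : S -> S -> \bar R).

Lemma path_cost_nil s : path_cost c s [::] = 0.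
Proof. exact: big_nil. Qed.

Lemma path_cost_cons s x p : path_cost c s (x :: p) = c s x + path_cost c x p.
Proof. exact: big_cons. Qed.

Lemma path_cost_cat s p q :
  path_cost c s (p ++ q) = path_cost c s p + path_cost c (last s p) q.
Proof. by rewrite /path_cost pairmap_cat big_cat. Qed.

(** Sequences of size at most [n] form a finite type, so a cheapest one exists. The single edge to
    [s'] shows that there is a candidate, which is where [0 < n] enters. *)
Lemma bounded_shortest_path n s s' : (0 < n)%N ->
  exists p, [/\ last s p = s', (size p <= n)%N &
    forall q, last s q = s' -> (size q <= n)%N ->
      path_cost c s p <= path_cost c s q].
Proof.
move=> n_gt0.
have size_edge : (size [:: s'] <= n)%N by [].
pose edge : n.-bseq S := Bseq size_edge.
have last_edge : last s edge == s' by [].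
case: (@arg_minP _ _ _ edge (fun p : n.-bseq S => last s p == s')
  (fun p : n.-bseq S => path_cost c s p) last_edge) => p /eqP lastp minp.
exists p; split => [//||q /eqP lastq sizeq]; first exact: size_bseq.
exact: (minp (Bseq sizeq)).
Qed.

(** Ensures that [V] is the cost of an actual path and never the default value of [minimum]. *)
Lemma V_attained k s s' :
  exists2 p, last s p = s' /\ (size p <= 2 ^ k)%N & V c k s s' = path_cost c s p.
Proof.
have [|p [lastp sizep minp]] := @bounded_shortest_path (2 ^ k) s s'.
  by rewrite expn_gt0.
exists p => //; apply: minimum_eq; first by exists p.
by move=> _ [q [lastq sizeq] <-]; exact: minp.
Qed.

Lemma V_le k s s' p : last s p = s' -> (size p <= 2 ^ k)%N ->
  V c k s s' <= path_cost c s p.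
Proof.
move=> lastp sizep.
have [|q [lastq sizeq minq]] := @bounded_shortest_path (2 ^ k) s s'.
  by rewrite expn_gt0.
rewrite /V (@minimum_eq _ _ (path_cost c s q)); [exact: minq|by exists q|].
by move=> _ [r [lastr sizer] <-]; exact: minq.
Qed.

Lemma V0_neq s s' : s != s' -> V c 0 s s' = c s s'.
Proof.
move=> ss'; have [[|x [|y p]] [/= lastp //]] := V_attained 0 s s'.
  by rewrite lastp eqxx in ss'.
by rewrite path_cost_cons path_cost_nil adde0 lastp.
Qed.

Lemma VS k s s' :
  V c k.+1 s s' = \big[mine/+oo]_(sm : S) (V c k s sm + V c k sm s').
Proof.
apply/eqP; rewrite eq_le; apply/andP; split.
  apply: le_bigmin => [|m _]; first exact: leey.
  have [p [lastp sizep] ->] := V_attained k s m.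
  have [q [lastq sizeq] ->] := V_attained k m s'.
  rewrite -lastp -path_cost_cat; apply: V_le.
    by rewrite last_cat lastp.
  by rewrite size_cat expnS mul2n -addnn leq_add.
have [p [lastp sizep] ->] := V_attained k.+1 s s'.
(* The node reached after [2 ^ k] steps, or [s'] itself if [p] is shorter. *)
pose m := last s (take (2 ^ k) p).
apply: (@le_trans _ _ (V c k s m + V c k m s')); first exact: bigmin_le_cond.
rewrite -[in leRHS](cat_take_drop (2 ^ k) p) path_cost_cat; apply: leeD; apply: V_le.
- by [].
- by rewrite size_take_min geq_minl.
- by rewrite -last_cat cat_take_drop.
- by rewrite size_drop leq_subLR addnn -mul2n -expnS.
Qed.

Hypothesis no_negative_cycle :
  forall (s : S) (p : seq S), ~ negative_cycle c s p.

Lemma cycle_cost_ge0 s p : last s p = s -> 0 <= path_cost c s p.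
Proof.
case: p => [|x p] lastp; first by rewrite path_cost_nil.
by rewrite leNgt; apply/negP => neg; apply: (@no_negative_cycle s (x :: p)).
Qed.

(** The empty path gives the upper bound, nonnegativity of closed paths the lower one. *)
Lemma V_diag k s : V c k s s = 0.
Proof.
apply/eqP; rewrite eq_le -{1}(path_cost_nil s) V_le//=.
by have [p [lastp _] ->] := V_attained k s s; exact: cycle_cost_ge0.
Qed.

Lemma simple_path_le s p : exists q,
  [/\ last s q = last s p, uniq (s :: q) & path_cost c s q <= path_cost c s p].
Proof.
elim: p s => [|x p IHp] s; first by exists [::].
have [q [lastq uniqq leqp]] := IHp x.
have cost_le : path_cost c s (x :: q) <= path_cost c s (x :: p).
  by rewrite !path_cost_cons leeD2l.
have {}lastq : last s (x :: q) = last x p by [].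
(* Treating [x :: q] as one sequence [r] lets a single argument cover both [s = x] and a later
   return to [s]. *)
move: (x :: q) lastq uniqq cost_le => r lastr uniqr cost_le.
have [s_in|s_notin] := boolP (s \in r); last first.
  by exists r; split; rewrite //= s_notin.
case/path.splitPr: s_in lastr uniqr cost_le => r1 r2 lastr uniqr cost_le.
exists r2; split.
- by rewrite [RHS]/= -lastr last_cat.
- by move: uniqr; rewrite cat_uniq => /and3P[].
(* The excised part [rcons r1 s] is a closed path at [s], hence has nonnegative cost. *)
- apply: le_trans cost_le; rewrite -cat_rcons path_cost_cat last_rcons.
  by rewrite leeDr// cycle_cost_ge0// last_rcons.
Qed.

Lemma V_eq_Vstar k s s' : (#|S| <= 2 ^ k)%N -> V c k s s' = Vstar c s s'.
Proof.
move=> card_le; have [p [lastp _] Vp] := V_attained k s s'.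
(* The bounded minimiser [p] also attains the minimum over the infinite set of all paths, once every
   [q] is compared with a simple path. *)
apply/esym/minimum_eq; first by exists p.
move=> _ [q lastq <-].
have [r [lastr uniqr cost_le]] := simple_path_le s q.
apply: le_trans cost_le; apply: V_le; first by rewrite lastr.
apply: leq_trans card_le; apply: ltnW.
(* With its start, a simple path of [size r] steps visits [(size r).+1] distinct nodes. *)
by rewrite -[(size r).+1]/(size (s :: r)) -(card_uniqP uniqr) max_card.
Qed.

End PathCost.

Theorem theorem1 (R : realType) (N : nat) (S : finType) (hN : #|S| = N)
    (c : S -> S -> \bar R)
    (c_noninfty : forall s s' : S, c s s' != -oo)
    (no_negative_cycle : forall (s : S) (p : seq S), ~ negative_cycle c s p) :
  [/\ forall s s' : S, s != s' -> V c 0 s s' = c s s',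
      forall (k : nat) (s : S), V c k s s = 0,
      forall (k : nat) (s s' : S), s != s' ->
        V c k.+1 s s' = \big[mine/+oo]_(sm : S) (V c k s sm + V c k sm s')
    & forall k : nat, (ln N%:R / ln 2 <= k%:R :> R)%R ->
        forall s s' : S, V c k s s' = Vstar c s s'].
Proof.
split=> [s s'|k s|k s s' _|k le_k s s'].
- exact: V0_neq.
- exact: V_diag.
- exact: VS.
- by apply: V_eq_Vstar => //; rewrite hN; exact: log2_le_leq_exp2 le_k.
Qed.
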